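(* Let $\Gamma$ be a connected $k$-regular graph with a simple eigenvalue $\lambda\neq k$ and corresponding spectral idempotent $E_\lambda$. Then $\Gamma$ has a full indubitable partition corresponding to $\lambda$ if and only if $E_\lambda$ has constant diagonal.
   Context: Graphs are finite, simple and undirected; eigenvalues of $\Gamma$ are those of its $01$-adjacency matrix $A$; an eigenvalue is simple if it has multiplicity $1$. The spectral idempotent $E_\lambda$ is the (real symmetric) matrix of the orthogonal projection onto $\ker(\lambda I-A)$. A partition $\Pi$ of the vertex set of a connected graph $\Gamma$ (into nonempty cells) is indubitable with parameters $(a,b)$ if for each cell $\mathcal{P}\in\Pi$ and each vertex $x$, the number of neighbors of $x$ in $\mathcal{P}$ equals $a$ if $x\in\mathcal{P}$, and equals $b$ otherwise. An indubitable partition with $r+1\ge2$ cells corresponds to the eigenvalue $\lambda=a-b$ of $\Gamma$; it is full (corresponding to $\lambda$) if $r$ equals the multiplicity of $\lambda$ as an eigenvalue of $\Gamma$ (so, for a simple eigenvalue, if it has two cells). *)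

(* Defs.v *)
From mathcomp Require Import all_boot all_order all_algebra.
From mathcomp Require Import reals.

Set Implicit Arguments.
Unset Strict Implicit.
Unset Printing Implicit Defensive.

Import Order.TTheory GRing.Theory Num.Theory.
Local Open Scope ring_scope.

(* A graph on the finite vertex set [T] is an adjacency relation [e : rel T]; *)
(* matrices over the vertices are indexed through [enum_val : 'I_#|T| -> T].  *)

Section Graph.
Variables (T : finType) (e : rel T).

Definition simple_graph := symmetric e /\ irreflexive e.

Definition connected_graph := forall x y : T, connect e x y.

Definition regular_graph (k : nat) := forall x : T, #|[set y | e x y]| = k.

Definition indubitable (a b : nat) (Pi : {set {set T}}) :=
  partition Pi [set: T] /\
  forall (P : {set T}) (x : T), P \in Pi ->
    #|[set y in P | e x y]| = if x \in P then a else b.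

Variable R : realType.

Definition adjmx : 'M[R]_#|T| :=
  \matrix_(i, j) (e (enum_val i) (enum_val j))%:R.

(* Dimension of the eigenspace; geometric and algebraic multiplicities agree  *)
(* because the adjacency matrix is real symmetric.                            *)
Definition multiplicity (l : R) : nat := \rank (eigenspace adjmx l).

Definition simple_eigenvalue (l : R) :=
  eigenvalue adjmx l /\ multiplicity l = 1%N.

(* The projection onto the eigenspace U along its orthogonal complement       *)
(* [kermx U^T] = {u | u *m U^T = 0}.  MathComp's subspaces are row spaces;    *)
(* since [adjmx] is symmetric they are also the column kernels, and the       *)
(* projection matrix is symmetric (see [spectral_idempotentP]).               *)
Definition spectral_idempotent (l : R) : 'M[R]_#|T| :=
  let U := eigenspace adjmx l in proj_mx U (kermx U^T).

Definition full_indubitable (l : R) (Pi : {set {set T}}) :=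
  exists a b : nat,
    [/\ indubitable a b Pi, l = a%:R - b%:R, (2 <= #|Pi|)%N
      & #|Pi| = (multiplicity l).+1].

End Graph.

Definition constant_diagonal (R : realType) (n : nat) (E : 'M[R]_n) :=
  exists c : R, forall i : 'I_n, E i i = c.

Section SanityCheck.
Variable R : realType.

Lemma row_dot_eq0 n (u : 'rV[R]_n) : u *m u^T = 0 -> u = 0.
Proof.
move=> /matrixP/(_ 0 0); rewrite !mxE => /eqP.
rewrite psumr_eq0 => [/allP u0|i _]; last by rewrite mxE -expr2 sqr_ge0.
apply/rowP => i; have /= := u0 i (mem_index_enum i).
by rewrite !mxE -expr2 sqrf_eq0 => /eqP.
Qed.

Lemma capmx_ortho n (U : 'M[R]_n) : (U :&: kermx U^T)%MS = 0.
Proof.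
apply/eqP/rowV0P => v; rewrite sub_capmx => /andP[/submxP[w ->] /sub_kermxP].
by move=> h; apply: row_dot_eq0; rewrite trmx_mul mulmxA h mul0mx.
Qed.

Lemma addsmx_ortho n (U : 'M[R]_n) (W : 'M[R]_n) : (W <= U + kermx U^T)%MS.
Proof.
apply: submx_full; rewrite /row_full mxrank_disjoint_sum ?capmx_ortho //.
by rewrite mxrank_ker mxrank_tr subnKC ?rank_leq_col.
Qed.

Lemma spectral_idempotentP (T : finType) (e : rel T) (l : R) :
  let E := spectral_idempotent e l in
  [/\ E^T = E, E *m E = E & (E :=: eigenspace (adjmx e R) l)%MS].
Proof.
move=> E; set U := eigenspace _ l.
have capU : (U :&: kermx U^T)%MS = 0 by exact: capmx_ortho.
have EU : (E <= U)%MS by rewrite -[E]mul1mx proj_mx_sub.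
have UE : U *m E = U by exact: proj_mx_id.
have EC : (1%:M - E) *m U^T = 0.
  apply/sub_kermxP; rewrite -[E]mul1mx.
  exact: proj_mx_compl_sub (addsmx_ortho _ _).
clearbody E; have [w Ew] := submxP EU.
have ET : E = E *m E^T.
  have : (1%:M - E) *m E^T = 0 by rewrite [in E^T]Ew trmx_mul mulmxA EC mul0mx.
  move/eqP; rewrite mulmxBl mul1mx subr_eq0 => /eqP h.
  by apply: trmx_inj; rewrite trmx_mul trmxK.
split.
- by rewrite {1}ET trmx_mul trmxK -ET.
- by rewrite {1}Ew -mulmxA UE -Ew.
- by apply/eqmxP; rewrite EU -[X in (X <= _)%MS]UE submxMl.
Qed.

End SanityCheck.

(* Main.v *)
(** When [l] is simple with eigenvector [v], the idempotent satisfies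
    [(v . v) E = v^T v], so [E] has constant diagonal exactly when all entries
    of [v] have the same absolute value, i.e. when [v] may be taken to be the
    signed indicator of a set [P] of vertices.  At a vertex with [s] neighbours
    on its own side of [P] and [o] on the other side, the eigenvector equation
    reads [s - o = l], while regularity reads [s + o = k]; hence [s] and [o] do
    not depend on the vertex and [{P, ~: P}] is indubitable.  Both sides are
    nonempty because otherwise [o = 0] and [l = k]. *)
Require Import Defs.
From mathcomp Require Import all_boot all_order all_algebra.
From mathcomp Require Import reals ring lra.
Set Implicit Arguments.
Unset Strict Implicit.
Unset Printing Implicit Defensive.
Import Order.TTheory GRing.Theory Num.Theory.
Local Open Scope ring_scope.

(** The two cells are disjoint and cover [T], so one determines the other; this lets a single set
    encode the whole partition. *)
Lemma card2_partitionP (T : finType) (Pi : {set {set T}}) :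
  partition Pi [set: T] -> #|Pi| = 2%N ->
  exists2 P : {set T}, P != set0 & Pi = [set P; ~: P].
Proof.
move=> /and3P[/eqP covPi trivPi Pi0] /eqP/cards2P[P [Q [neqPQ PiE]]].
exists P; first by apply: contraNneq Pi0 => <-; rewrite PiE set21.
suff -> : ~: P = Q by [].
have disPQ : [disjoint P & Q].
  by move/trivIsetP: trivPi; apply; rewrite ?PiE ?set21 ?set22.
have PQT : P :|: Q = [set: T].
  by rewrite -covPi /cover PiE big_setU1 ?inE //= big_set1.
apply/setP => x; move/setP/(_ x): PQT; rewrite !inE.
by have [/(disjointFr disPQ) ->|] := boolP (x \in P).
Qed.

Lemma partition_setC (T : finType) (P : {set T}) :
  P != set0 -> P != [set: T] ->
  partition [set P; ~: P] [set: T] /\ #|[set P; ~: P]| = 2%N.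
Proof.
move=> P0 PT.
have CP0 : ~: P != set0.
  by apply: contraNneq PT => CP0; rewrite -[P]setCK CP0 setC0.
have PC : P != ~: P.
  apply: contra_neq P0 => PC; apply/setP => x; move/setP/(_ x): PC.
  by rewrite !inE; case: (x \in P).
split; last by rewrite cards2 PC.
rewrite /partition /cover big_setU1 ?inE //= big_set1 setUCr eqxx /=.
rewrite !(eq_sym set0) negb_or P0 CP0 !andbT.
apply/trivIsetP => A B; rewrite !inE => /orP[]/eqP-> /orP[]/eqP->;
  by rewrite ?eqxx // -setI_eq0 ?setICr // setIC setICr.
Qed.

Section Eigenvectors.
Variables (R : realType) (T : finType) (e : rel T).
Hypothesis sym_e : symmetric e.
Implicit Types (f : T -> R) (l : R) (P : {set T}).

Let row_of f : 'rV[R]_#|T| := \row_i f (enum_val i).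

Lemma eigenspace_rowP f l :
  reflect (forall x, \sum_(y | e x y) f y = l * f x)
          (row_of f <= eigenspace (adjmx e R) l)%MS.
Proof.
(* A row vector multiplies from the left, so entry [i] collects the edges pointing into [i];
   symmetry of [e] turns them into edges leaving [i]. *)
have mulE i : (row_of f *m adjmx e R) 0 i = \sum_(y | e (enum_val i) y) f y.
  rewrite mxE [RHS]big_mkcond (reindex _ (onW_bij _ (@enum_val_bij T))) /=.
  by apply: eq_bigr => j _; rewrite !mxE sym_e; case: e; rewrite ?mulr1 ?mulr0.
apply: (iffP eigenspaceP) => [fl x|fl].
  by move/rowP/(_ (enum_rank x)): fl; rewrite mulE !mxE enum_rankK.
by apply/rowP => i; rewrite mulE fl !mxE.
Qed.

(** The row space of [E] is the line spanned by [v], so [E = w *m v] for some column [w]. Since [E]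
    is symmetric and fixes [v], [v = v *m E^T = (v *m v^T) *m w^T], which identifies [w] up to the
    factor [v *m v^T]. *)
Lemma spectral_idempotent_rank1 l (v : 'rV[R]_#|T|) :
  multiplicity e l = 1%N -> v != 0 -> (v <= eigenspace (adjmx e R) l)%MS ->
  forall i j, (v *m v^T) 0 0 * spectral_idempotent e l i j = v 0 i * v 0 j.
Proof.
move=> mult1 v0 vU i j.
have [ET EE EU] := spectral_idempotentP e l.
set E := spectral_idempotent e l in ET EE EU *.
have vE : (v <= E)%MS by rewrite EU.
have Ev : (E <= v)%MS.
  rewrite -(geq_leqif (mxrank_leqif_sup vE)) EU.
  by rewrite rank_rV v0 [\rank _]mult1.
have [w Ew] := submxP Ev.
have vEv : v *m E = v by have [u ->] := submxP vE; rewrite -mulmxA EE.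
have vw : v = (v *m v^T) 0 0 *: w^T.
  by rewrite -mul_scalar_mx -mx11_scalar -mulmxA -trmx_mul -Ew ET.
set s := (v *m v^T) 0 0 in vw *; move: s vw => s /rowP/(_ i).
by rewrite Ew !mxE big_ord1 => ->; rewrite mulrA.
Qed.

Definition signed_indicator P (x : T) : R := if x \in P then 1 else -1.

Lemma sum_signed_indicator P x :
  \sum_(y | e x y) signed_indicator P y =
  #|[set y in P | e x y]|%:R - #|[set y in ~: P | e x y]|%:R.
Proof.
rewrite (bigID (mem P)) /=; congr (_ + _).
  rewrite -sum1_card natr_sum; apply: eq_big => [y|y /andP[_ yP]].
    by rewrite !inE andbC.
  by rewrite /signed_indicator yP.
rewrite -sum1_card natr_sum -sumrN; apply: eq_big => [y|y /andP[_ yP]].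
  by rewrite !inE andbC.
by rewrite /signed_indicator (negbTE yP).
Qed.

Lemma card_neighbours_setC P x :
  (#|[set y in P | e x y]| + #|[set y in ~: P | e x y]|)%N = #|[set y | e x y]|.
Proof.
rewrite -(cardsID P [set y | e x y]).
by congr (_ + _)%N; apply: eq_card => y; rewrite !inE // andbC.
Qed.

(** The signed sum over the neighbours of [x] is [a - b] inside [P] and [b - a] outside, that is,
    [l] times the sign of [x]. *)
Lemma full_indubitable_signed_eigenvector l (Pi : {set {set T}}) :
  multiplicity e l = 1%N -> full_indubitable e l Pi ->
  exists P, forall x,
    \sum_(y | e x y) signed_indicator P y = l * signed_indicator P x.
Proof.
move=> mult1 [a [b [[partPi degPi] lE _ cardPi]]].
rewrite mult1 in cardPi; have [P _ PiE] := card2_partitionP partPi cardPi.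
exists P => x; rewrite sum_signed_indicator !degPi ?PiE ?set21 ?set22 // inE.
by rewrite lE /signed_indicator; case: (x \in P) => /=; ring.
Qed.

Lemma signed_eigenvector_full_indubitable k l P (x0 : T) :
  regular_graph e k -> l <> k%:R -> multiplicity e l = 1%N ->
  (forall x, \sum_(y | e x y) signed_indicator P y = l * signed_indicator P x) ->
  full_indubitable e l [set P; ~: P].
Proof.
move=> reg_e l_neq_k mult1 eigP.
pose d (C : {set T}) x := #|[set y in C | e x y]|.
pose same x := d (if x \in P then P else ~: P) x.
pose other x := d (if x \in P then ~: P else P) x.
have sumE x : (same x + other x)%N = k.
  rewrite -(reg_e x) -(card_neighbours_setC P) /same /other /d.
  by case: (x \in P) => //; rewrite addnC.
have diffE x : (same x)%:R - (other x)%:R = l.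
  have := eigP x; rewrite sum_signed_indicator /same /other /d.
  by rewrite /signed_indicator; case: (x \in P) => ?; lra.
have other_gt0 x : (0 < other x)%N.
  rewrite lt0n; apply/eqP => o0; apply: l_neq_k.
  by rewrite -(diffE x) -(sumE x) o0 subr0 addn0.
(* The difference may be negative, so the linear system is solved in [R] and the result is carried
   back to [nat] by injectivity of the embedding. *)
have sameE x : same x = same x0.
  apply/eqP; rewrite -(eqr_nat R); apply/eqP.
  have : (same x)%:R + (other x)%:R = (same x0)%:R + (other x0)%:R :> R.
    by rewrite -!natrD !sumE.
  by have := diffE x; have := diffE x0; lra.
have otherE x : other x = other x0.
  by have := sumE x; rewrite -(sumE x0) sameE => /addnI.
have [partP cardP] : partition [set P; ~: P] [set: T] /\ #|[set P; ~: P]| = 2%N.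
  (* The vertex [x0] and a neighbour [y] on the opposite side witness that both cells are
     nonempty. *)
  have := other_gt0 x0; rewrite /other /d => /card_gt0P[y]; rewrite !inE.
  by case: ifP => x0P /andP[yP _]; apply: partition_setC; apply/eqP => PE;
    move: x0P yP; rewrite PE !inE.
exists (same x0), (other x0); split; rewrite ?diffE ?cardP ?mult1 //.
split=> // C x; rewrite -(sameE x) -(otherE x) /same /other /d !inE.
by case/orP=> /eqP ->; rewrite ?inE; case: (x \in P).
Qed.

Lemma constant_square_signed_eigenvector l f d :
  d != 0 -> (forall x, f x ^+ 2 = d) ->
  (forall x, \sum_(y | e x y) f y = l * f x) ->
  exists P, forall x,
    \sum_(y | e x y) signed_indicator P y = l * signed_indicator P x.
Proof.
move=> d0 fd eigf; pose P := [set x | 0 <= f x]; exists P => x.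
(* All values of [f] have absolute value [sqrt d], and [P] records their signs. *)
have fE y : f y = Num.sqrt d * signed_indicator P y.
  rewrite -(fd y) sqrtr_sqr /signed_indicator inE.
  by case: ger0P => _; rewrite ?mulr1 // mulrN1 opprK.
(* Positivity of [d] comes from its being the square [f x ^+ 2] and nonzero. *)
have s0 : Num.sqrt d != 0 by rewrite sqrtr_eq0 -ltNge lt0r d0 -(fd x) sqr_ge0.
apply: (mulfI s0); rewrite mulr_sumr mulrCA -fE -eigf.
by apply: eq_bigr => y _; rewrite fE.
Qed.

Lemma signed_eigenvector_constant_diagonal l P :
  multiplicity e l = 1%N ->
  (forall x, \sum_(y | e x y) signed_indicator P y = l * signed_indicator P x) ->
  constant_diagonal (spectral_idempotent e l).
Proof.
move=> mult1 /eigenspace_rowP; set v := row_of _ => vU.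
have v1 i : v 0 i * v 0 i = 1.
  by rewrite mxE /signed_indicator; case: ifP; rewrite ?mulr1 // mulrNN mulr1.
(* The entries of [v] are signs, so the rank-one formula reads [(v *m v^T) 0 0 * E i i = 1], which
   also shows that this scalar is nonzero. *)
exists ((v *m v^T) 0 0)^-1 => i.
have v0 : v != 0.
  by apply/eqP => v0; have /eqP := v1 i; rewrite v0 mxE mulr0 eq_sym oner_eq0.
have := spectral_idempotent_rank1 mult1 v0 vU i i; rewrite v1 => sE.
have s0 : (v *m v^T) 0 0 != 0.
  by apply/eqP => s0; move/eqP: sE; rewrite s0 mul0r eq_sym oner_eq0.
by apply: (mulfI s0); rewrite sE divff.
Qed.

Lemma constant_diagonal_signed_eigenvector l :
  simple_eigenvalue e l -> constant_diagonal (spectral_idempotent e l) ->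
  exists P, forall x,
    \sum_(y | e x y) signed_indicator P y = l * signed_indicator P x.
Proof.
move=> [/eigenvalueP[v /eigenspaceP vU v0] mult1] [c Ec].
have diagE := spectral_idempotent_rank1 mult1 v0 vU.
pose f x := v 0 (enum_rank x).
have vE : v = row_of f by apply/rowP => i; rewrite mxE /f enum_valK.
apply: (@constant_square_signed_eigenvector l f ((v *m v^T) 0 0 * c)).
(* If the common value of the squares were zero, every entry of the eigenvector [v] would vanish. *)
- apply: contra_neq v0 => sc0; apply/rowP => i; apply/eqP.
  by rewrite mxE -sqrf_eq0 expr2 -diagE Ec sc0.
- by move=> x; rewrite expr2 -diagE Ec.
- by apply/eigenspace_rowP; rewrite -vE.
Qed.

End Eigenvectors.

Theorem proposition4p1 (R : realType) (T : finType) (e : rel T) (k : nat) (l : R)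
  (simple_e : simple_graph e) (conn_e : connected_graph e)
  (reg_e : regular_graph e k)
  (simple_l : simple_eigenvalue e l) (l_neq_k : l <> k%:R) :
  (exists Pi : {set {set T}}, full_indubitable e l Pi) <->
  constant_diagonal (spectral_idempotent e l).
Proof.
have [sym_e _] := simple_e; have [/eigenvalueP[v _ v0] mult1] := simple_l.
split=> [[Pi fullPi]|constE].
  have [P eigP] := full_indubitable_signed_eigenvector mult1 fullPi.
  exact: signed_eigenvector_constant_diagonal eigP.
(* A nonzero eigenvector has a coordinate, which supplies the reference vertex at which the
   parameters are read off. *)
have [i _] := rV0Pn _ v0.
have [P eigP] := constant_diagonal_signed_eigenvector sym_e simple_l constE.
exists [set P; ~: P].
exact: (signed_eigenvector_full_indubitable (enum_val i) reg_e).
Qed.
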